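(* Let $m\in\mathbb{N}_0$, $n\geq 0$ an integer, and $x\in\mathbb{C}$. Then $$P_{n,M}(x;m)=\sum_{\ell=0}^{n}\binom{n}{\ell}_M x^\ell\sum_{j=0}^{n-\ell}(m)_jS_M(n-\ell,j),$$ where $(m)_0=1$ and $(m)_j=m(m-1)\cdots(m-j+1)$ for $j\geq 1$.
   Context: $\mathbb{N}_0=\{0,1,2,\ldots\}$. For $n\ge 0$, $M_n=2^n-1$. The M-factorial is $M_0!=1$ and $M_n!=M_nM_{n-1}\cdots M_1$ for $n\geq 1$. The M-binomial coefficient is $\binom{n}{k}_M=\frac{M_n!}{M_k!M_{n-k}!}$ for $0\le k\le n$. The M-exponential is $e_M^{xt}=\sum_{n=0}^{\infty}\frac{x^nt^n}{M_n!}$, and $e_M^t$ denotes the case $x=1$. For $m\in\mathbb{N}_0$ the Mersenne translation polynomials $P_{n,M}(x;m)$ are defined by $e_M^{xt}\left(e_M^t\right)^m=\sum_{n=0}^{\infty}P_{n,M}(x;m)\frac{t^n}{M_n!}$, where $(e_M^t)^m$ is the ordinary $m$-fold product. For $j\in\mathbb{N}_0$ the M-Stirling numbers of the second kind $S_M(n,j)$ are defined by $\frac{(e_M^t-1)^j}{j!}=\sum_{n=0}^{\infty}S_M(n,j)\frac{t^n}{M_n!}$, i.e. $S_M(n,j)=\frac{M_n!}{j!}[t^n](e_M^t-1)^j$, where $j!$ is the ordinary factorial and $[t^n]$ denotes the coefficient of $t^n$. *)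

(* Defs.v *)
From mathcomp Require Import all_boot all_order all_algebra.
From mathcomp Require Import complex reals.

Set Implicit Arguments.
Unset Strict Implicit.
Unset Printing Implicit Defensive.

Import Order.TTheory GRing.Theory Num.Theory.

Local Open Scope ring_scope.

(* A formal power series in t is the sequence of its coefficients [t^n], and   *)
(* multiplication is the Cauchy product (not the pointwise one).              *)
Definition fps (K : fieldType) : Type := nat -> K.

Definition fps_one (K : fieldType) : fps K := fun n => (n == 0)%:R.

Definition fps_sub (K : fieldType) (f g : fps K) : fps K :=
  fun n => f n - g n.

Definition fps_mul (K : fieldType) (f g : fps K) : fps K :=
  fun n => \sum_(i < n.+1) f i * g (n - i)%N.

Definition fps_exp (K : fieldType) (f : fps K) (m : nat) : fps K :=
  iter m (fps_mul f) (fps_one K).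

Definition mersenne (n : nat) : nat := (2 ^ n - 1)%N.

Definition mfact (n : nat) : nat := (\prod_(1 <= k < n.+1) mersenne k)%N.

(* Only meaningful for k <= n, since n - k is truncated.                      *)
Definition mbinom (K : fieldType) (n k : nat) : K :=
  (mfact n)%:R / ((mfact k)%:R * (mfact (n - k))%:R).

(* The series e_M^{xt}; e_M^t is mexp 1.                                      *)
Definition mexp (K : fieldType) (x : K) : fps K :=
  fun n => x ^+ n / (mfact n)%:R.

(* P_{n,M}(x;m) = M_n! [t^n] e_M^{xt} (e_M^t)^m; see mtransl_gf.              *)
Definition mtransl (K : fieldType) (n : nat) (x : K) (m : nat) : K :=
  (mfact n)%:R * fps_mul (mexp x) (fps_exp (mexp 1) m) n.

(* S_M(n,j) = (M_n! / j!) [t^n] (e_M^t - 1)^j; see mstirling2_gf.             *)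
Definition mstirling2 (K : fieldType) (n j : nat) : K :=
  (mfact n)%:R / j`!%:R * fps_exp (fps_sub (mexp 1) (fps_one K)) j n.

Lemma mfact_gt0 (n : nat) : (0 < mfact n)%N.
Proof.
rewrite /mfact big_seq; apply: prodn_cond_gt0 => k.
by rewrite mem_index_iota => /andP[k_gt0 _]; rewrite subn_gt0 -{1}(expn0 2) ltn_exp2l.
Qed.

Lemma mtransl_gf (K : numFieldType) (x : K) (m n : nat) :
  fps_mul (mexp x) (fps_exp (mexp 1) m) n = mtransl n x m / (mfact n)%:R.
Proof.
by rewrite /mtransl mulrC mulKf // pnatr_eq0 -lt0n mfact_gt0.
Qed.

Lemma mstirling2_gf (K : numFieldType) (j n : nat) :
  fps_exp (fps_sub (mexp 1) (fps_one K)) j n / j`!%:R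
    = mstirling2 K n j / (mfact n)%:R.
Proof.
rewrite /mstirling2 -mulrA [RHS]mulrC mulKf 1?mulrC //.
by rewrite pnatr_eq0 -lt0n mfact_gt0.
Qed.

(* Main.v *)
Require Import Defs.
From mathcomp Require Import all_boot all_order all_algebra.
From mathcomp Require Import complex reals.

(** Write [g] for the M-exponential series.  Its constant coefficient is [1], so
    [g = (g - 1) + 1] and the ordinary binomial theorem gives
    [g ^ m = \sum_j 'C(m, j) (g - 1) ^ j].  As [g - 1] is divisible by [t], the
    power [(g - 1) ^ j] does not contribute to the coefficient of [t ^ k] when
    [j > k]: the sum may be cut at [j = k], independently of [m].  Since
    ['C(m, j) = m ^_ j / j`!], the coefficient of [t ^ k] in [g ^ m] is then the
    sum of the [m ^_ j * S_M(k, j) / M_k!] (lemma [fps_exp_mexp1]), and the theorem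
    is the Cauchy product of this with the series of [e_M^{xt}].

    The binomial theorem itself is imported from the ring of polynomials: the
    coefficients of index [< N] of a product of series are those of the product
    of the truncations at order [N] (lemma [coef_fps_exp]). *)

Local Open Scope ring_scope.
Import GRing.Theory Num.Theory.

(** Truncation is compatible with products below the truncation order, because
    the Cauchy product at [k] reads only coefficients of index at most [k]. *)
Lemma coef_fps_exp (K : fieldType) (f : fps K) (m N k : nat) :
  (k < N)%N -> fps_exp f m k = ((\poly_(i < N) f i) ^+ m)`_k.
Proof.
elim: m k => [|m IHm] k ltkN; first by rewrite expr0 coef1.
rewrite exprS coefM /= /fps_mul; apply: eq_bigr => i _.
rewrite coef_poly (leq_ltn_trans _ ltkN) -1?ltnS //.
by rewrite -IHm // (leq_ltn_trans (leq_subr _ _)).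
Qed.

(** A series without constant term is divisible by [t], hence its [j]-th power
    by [t ^ j]. *)
Lemma fps_exp_eq0 (K : fieldType) (f : fps K) (j k : nat) :
  f 0%N = 0 -> (k < j)%N -> fps_exp f j k = 0.
Proof.
move=> f0; elim: j k => [//|j IHj] k ltkj /=.
rewrite /fps_mul big_ord_recl f0 mul0r add0r big1 // => i _.
rewrite IHj ?mulr0 //= /bump /= add1n.
by case: k ltkj i => [|k] ltkj [i lti] //=; rewrite subSS (leq_ltn_trans (leq_subr _ _)).
Qed.

Lemma fps_exp_binomial (K : fieldType) (g : fps K) (m k : nat) :
  fps_exp g m k =
    \sum_(j < m.+1) 'C(m, j)%:R * fps_exp (fps_sub g (fps_one K)) j k.
Proof.
rewrite (@coef_fps_exp _ g m k.+1) //.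
have -> : \poly_(i < k.+1) g i
          = \poly_(i < k.+1) (fps_sub g (fps_one K)) i + 1.
  apply/polyP => i; rewrite coefD !coef_poly coef1 /fps_sub /fps_one.
  by case: ltnP => [_|]; [rewrite subrK | case: i => // i _; rewrite addr0].
rewrite exprD1n coef_sum; apply: eq_bigr => j _.
by rewrite coefMn -coef_fps_exp // mulr_natl.
Qed.

(** The binomial expansion stops at [j = m] and the order of vanishing stops it
    at [j = k]: both sums are compared through the range [j <= m + k]. *)
Lemma fps_exp_binomial_trunc (K : fieldType) (g : fps K) (m k : nat) :
  g 0%N = 1 ->
  fps_exp g m k =
    \sum_(0 <= j < k.+1) 'C(m, j)%:R * fps_exp (fps_sub g (fps_one K)) j k.
Proof.
move=> g0; rewrite fps_exp_binomial.
pose F j : K := 'C(m, j)%:R * fps_exp (fps_sub g (fps_one K)) j k.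
rewrite -(big_mkord xpredT F).
have Fm j : (m < j)%N -> F j = 0 by move=> ltmj; rewrite /F bin_small ?mul0r.
have Fk j : (k < j)%N -> F j = 0.
  move=> ltkj; rewrite /F fps_exp_eq0 ?mulr0 //.
  by rewrite /fps_sub /fps_one g0 subrr.
have extend a : (forall j, (a < j)%N -> F j = 0) ->
    forall b, (a <= b)%N -> \sum_(0 <= j < a.+1) F j = \sum_(0 <= j < b.+1) F j.
  move=> Fa b leab; rewrite [RHS](@big_cat_nat _ _ _ a.+1) //=.
  by rewrite [X in _ + X]big_nat [X in _ + X]big1 ?addr0 // => j /andP[/Fa].
by rewrite (extend m Fm (m + k)%N) ?leq_addr // (extend k Fk (m + k)%N) ?leq_addl.
Qed.

(** The case [x = 0] of the theorem: the M-Stirling numbers absorb the division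
    by [j`!] that turns binomial coefficients into falling factorials. *)
Lemma fps_exp_mexp1 (K : numFieldType) (m k : nat) :
  fps_exp (mexp (1 : K)) m k =
    (\sum_(0 <= j < k.+1) (m ^_ j)%:R * mstirling2 K k j) / (mfact k)%:R.
Proof.
have g0 : mexp (1 : K) 0%N = 1.
  by rewrite /mexp expr0 /mfact big_geq // divr1.
rewrite fps_exp_binomial_trunc // mulr_suml; apply: eq_bigr => j _.
rewrite -[RHS]mulrA -mstirling2_gf -bin_ffact natrM.
by rewrite mulrCA !mulrA [RHS]mulfK 1?mulrC // pnatr_eq0 -lt0n fact_gt0.
Qed.

Theorem theorem4p2 (R : realType) (m n : nat) (x : R[i]) :
  mtransl n x m =
    \sum_(0 <= l < n.+1)
       mbinom R[i] n l * x ^+ l *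
       \sum_(0 <= j < (n - l).+1) (m ^_ j)%:R * mstirling2 R[i] (n - l) j.
Proof.
rewrite /mtransl /fps_mul mulr_sumr big_mkord; apply: eq_bigr => l _.
rewrite fps_exp_mexp1 /mexp /mbinom invfM -!mulrA; congr (_ * _).
by rewrite mulrCA; congr (_ * _); rewrite [RHS]mulrC mulrA.
Qed.
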